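(* Let $S$ be a numerical semigroup with multiplicity three and let $I\in\mathfrak{I}_0(S)\setminus\{S\}$. Then the following are equivalent: (1) $I$ is $+$-irreducible; (2) $I$ is $\vee$-irreducible; (3) $I$ is $\cup$-irreducible; (4) $I\in\mathfrak{P}_0(S)$.
   Context: $\mathbb{N}$ denotes the set of non-negative integers. A numerical semigroup is a submonoid $S$ of $(\mathbb{N},+)$ with $\mathbb{N}\setminus S$ finite; the elements of $\mathbb{N}\setminus S$ are the gaps of $S$. The multiplicity of $S$ is the least positive integer belonging to $S$. A (relative) ideal of $S$ is a subset $I\subseteq\mathbb{Z}$ such that $I+S=I$ and $z+I\subseteq S$ for some integer $z$. An ideal $I$ is normalized if $\min(I)=0$; $\mathfrak{I}_0(S)$ denotes the (finite) set of normalized ideals of $S$. It is a monoid under $I+J=\{i+j : i\in I, j\in J\}$, with identity $S$. For $I,J\in\mathfrak{I}_0(S)$, write $I\preceq J$ if there exists $K\in\mathfrak{I}_0(S)$ with $I+K=J$; this is a partial order. When $S$ has multiplicity three, $(\mathfrak{I}_0(S),\preceq)$ is known to be a lattice; $\vee$ denotes the supremum with respect to $\preceq$. The union of two normalized ideals of $S$ is again a normalized ideal of $S$. An ideal $I\in\mathfrak{I}_0(S)\setminus\{S\}$ is $+$-irreducible if $I=J+K$ with $J,K\in\mathfrak{I}_0(S)$ implies $I=J$ or $I=K$. An ideal $I\in\mathfrak{I}_0(S)$ is $\vee$-irreducible if there are no $J,K\in\mathfrak{I}_0(S)\setminus\{I\}$ with $I=J\vee K$. It is $\cup$-irreducible if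 there are no $J,K\in\mathfrak{I}_0(S)\setminus\{I\}$ with $I=J\cup K$. Finally, $\mathfrak{P}_0(S)=\{\{0,g\}+S : g \text{ is a gap of } S\}$. *)

(* Defs.v *)
From HB Require Import structures.
From mathcomp Require Import all_boot all_order all_algebra.
From mathcomp Require Import all_classical.

Set Implicit Arguments.
Unset Strict Implicit.
Unset Printing Implicit Defensive.

Import Order.TTheory GRing.Theory Num.Theory.
Local Open Scope classical_set_scope.
Local Open Scope ring_scope.

Definition numerical_semigroup (S : set nat) : Prop :=
  [/\ S 0%N, forall m n : nat, S m -> S n -> S (m + n)%N & finite_set (~` S)].

Definition gaps (S : set nat) : set nat := ~` S.

Definition is_multiplicity (S : set nat) (m : nat) : Prop :=
  [/\ (0 < m)%N, S m & forall n : nat, (0 < n)%N -> S n -> (m <= n)%N].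

(* Semigroups live in nat while their ideals live in int; [zset S] is S seen as
   a set of integers, and is in particular the identity ideal of S. *)
Definition zset (S : set nat) : set int := [set n%:Z | n in S].

Definition addset (I J : set int) : set int :=
  [set i + j | i in I & j in J].

Definition ideal (S : set nat) (I : set int) : Prop :=
  addset I (zset S) = I /\
  exists z : int, addset [set z] I `<=` zset S.

Definition normalized (I : set int) : Prop :=
  I 0 /\ forall i : int, I i -> 0 <= i.

Definition normalized_ideals (S : set nat) : set (set int) :=
  [set I | ideal S I /\ normalized I].

Definition ideal_le (S : set nat) (I J : set int) : Prop :=
  exists2 K : set int, normalized_ideals S K & addset I K = J.

(* [is_join S J K L] states that L is the supremum of J and K in the poset
   of normalized ideals of S ordered by [ideal_le S]; it renders L = J \vee K
   without choosing a join function. *)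
Definition is_join (S : set nat) (J K L : set int) : Prop :=
  [/\ normalized_ideals S L, ideal_le S J L, ideal_le S K L &
      forall M : set int, normalized_ideals S M ->
        ideal_le S J M -> ideal_le S K M -> ideal_le S L M].

Definition add_irreducible (S : set nat) (I : set int) : Prop :=
  [/\ normalized_ideals S I, I <> zset S &
      forall J K : set int, normalized_ideals S J -> normalized_ideals S K ->
        I = addset J K -> I = J \/ I = K].

Definition join_irreducible (S : set nat) (I : set int) : Prop :=
  normalized_ideals S I /\
  ~ exists J K : set int,
      [/\ (normalized_ideals S `\ I) J, (normalized_ideals S `\ I) K &
          is_join S J K I].

Definition union_irreducible (S : set nat) (I : set int) : Prop :=
  normalized_ideals S I /\
  ~ exists J K : set int,
      [/\ (normalized_ideals S `\ I) J, (normalized_ideals S `\ I) K &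
          I = J `|` K].

Definition two_generated_ideals (S : set nat) : set (set int) :=
  [set addset [set 0; g%:Z] (zset S) | g in gaps S].

(* Main.v *)
Require Import Defs.
From HB Require Import structures.
From mathcomp Require Import all_boot all_order all_algebra.
From mathcomp Require Import all_classical.
From mathcomp Require Import zify.

Set Implicit Arguments.
Unset Strict Implicit.
Unset Printing Implicit Defensive.

Local Open Scope classical_set_scope.
Local Open Scope ring_scope.

(** The equivalence rests on one decomposition. Write P x for {0, x} + S, let
    I be a normalized ideal, and let x and y be the least elements of I in the
    residue classes 1 and 2 modulo 3. Since 3 is in S, every element of I lies
    in S, in x + S or in y + S, so I = P x `|` P y. Moreover x + y is a
    nonnegative multiple of 3, hence in S, so that also P x + P y = I; and I is
    the supremum of P x and P y ([is_join_two_gen]), because an upper bound M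
    of both can be recovered as M = I + (M : I), where (M : I) is the set of z
    with z + I contained in M. Thus an ideal that is irreducible in any of the
    three senses equals P x or P y, and if it is not S then the generator
    is a gap.

    The remaining implications hold for every numerical semigroup. If
    {0, g} + S = J + K, write g = j + k. Unless g is in J or in K, both j and k
    are elements of {0, g} + S smaller than g, so they belong to S, and g would
    not be a gap ([two_gen_add_irreducible]). A union containing g has a
    member containing g, which settles unions. Finally a +-irreducible ideal
    I is \/-irreducible: if I is the join of J and K, both different from I,
    then J + J' = I forces J' = I, and so I, which lies below the upper bound
    J + K, is caught between J + K and J + I = I. *)

(** * Normalized ideals of a numerical semigroup *)

Lemma semigroup_conductor (S : set nat) :
  numerical_semigroup S -> exists c, forall n, (c <= n)%N -> S n.
Proof.
case=> _ _ /finite_seqP[s sE]; exists (\max_(i <- s) i).+1 => n ltn.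
apply: contrapT => nSn.
have : n \in s by have : (~` S) n by []; rewrite sE.
by move=> /leq_bigmax_seq-/(_ xpredT id isT); rewrite leqNgt ltn.
Qed.

Lemma zset_nat (S : set nat) n : zset S n%:Z <-> S n.
Proof. by split=> [[m Sm [<-]]//|Sn]; exists n. Qed.

Lemma zset_ge0 (S : set nat) i : zset S i -> 0 <= i.
Proof. by case=> n _ <-. Qed.

Lemma zset0 (S : set nat) : numerical_semigroup S -> zset S 0.
Proof. by case=> S0 _ _; exists 0%N. Qed.

Lemma zsetD (S : set nat) i j :
  numerical_semigroup S -> zset S i -> zset S j -> zset S (i + j).
Proof.
by case=> _ SD _ [m Sm <-] [n Sn <-]; exists (m + n)%N; [exact: SD|lia].
Qed.

(** Translation by the conductor carries every set of nonnegative integers into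
    S, so a normalized ideal is just a set with least element 0 that absorbs
    addition of elements of S. *)
Lemma normalized_idealsP (S : set nat) (I : set int) :
  numerical_semigroup S ->
  normalized_ideals S I <->
  [/\ I 0, forall i, I i -> 0 <= i &
      forall i s, I i -> zset S s -> I (i + s)].
Proof.
move=> hS; split=> [[[IS _] [I0 Ige0]]|[I0 Ige0 IS]].
  by split=> // i s Ii Ss; rewrite -IS; exists i => //; exists s.
split=> //; split.
  apply/seteqP; split=> [_ [i Ii [s Ss <-]]|i Ii]; first exact: IS.
  by exists i => //; exists 0; [exact: zset0|lia].
have [c cS] := semigroup_conductor hS.
exists c%:Z => _ [_ -> [i Ii <-]]; have := Ige0 i Ii.
case: i {Ii} => // n _; exists (c + n)%N; last by lia.
by apply: cS; lia.
Qed.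

Lemma zset_sub_ideal (S : set nat) (I : set int) :
  numerical_semigroup S -> normalized_ideals S I -> zset S `<=` I.
Proof.
move=> hS /(normalized_idealsP _ hS)[I0 _ IS] s Ss.
by rewrite -[s]GRing.add0r; exact: IS.
Qed.

Lemma addsetC (I J : set int) : addset I J = addset J I.
Proof.
apply/seteqP; split=> _ [i Ii [j Jj <-]];
  by exists j => //; exists i => //; lia.
Qed.

Lemma sub_addsetl (I J : set int) : J 0 -> I `<=` addset I J.
Proof. by move=> J0 i Ii; exists i => //; exists 0 => //; lia. Qed.

Lemma normalized_addset (S : set nat) (I J : set int) :
  numerical_semigroup S -> normalized_ideals S I -> normalized_ideals S J ->
  normalized_ideals S (addset I J).
Proof.
move=> hS /(normalized_idealsP _ hS)[I0 Ige0 IS].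
move=> /(normalized_idealsP _ hS)[J0 Jge0 JS]; apply/normalized_idealsP => //.
split=> [|_ [i Ii [j Jj <-]]|_ s [i Ii [j Jj <-]] Ss].
- by exists 0 => //; exists 0.
- by have := Ige0 _ Ii; have := Jge0 _ Jj; lia.
- by exists i => //; exists (j + s); [exact: JS|lia].
Qed.

Lemma normalized_setU (S : set nat) (I J : set int) :
  numerical_semigroup S -> normalized_ideals S I -> normalized_ideals S J ->
  normalized_ideals S (I `|` J).
Proof.
move=> hS /(normalized_idealsP _ hS)[I0 Ige0 IS].
move=> /(normalized_idealsP _ hS)[_ Jge0 JS]; apply/normalized_idealsP => //.
split=> [|i [/Ige0|/Jge0]//|i s [Ii|Ji] Ss]; first by left.
- by left; exact: IS.
- by right; exact: JS.
Qed.

Lemma ideal_le_sub (S : set nat) (I J : set int) :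
  numerical_semigroup S -> ideal_le S I J -> I `<=` J.
Proof.
move=> hS [K /(normalized_idealsP _ hS)[K0 _ _] <-].
exact: sub_addsetl.
Qed.

(** * Ideals generated by 0 and one more element *)

Definition two_gen (S : set nat) (x : int) : set int :=
  addset [set 0; x] (zset S).

Lemma two_genP (S : set nat) x i :
  two_gen S x i <-> zset S i \/ zset S (i - x).
Proof.
split=> [[_ [->|->] [s Ss <-]]|[Si|Si]].
- by left; rewrite GRing.add0r.
- by right; have -> : x + s - x = s by lia.
- by exists 0; [left|exists i => //; lia].
- by exists x; [right|exists (i - x) => //; lia].
Qed.

Lemma two_gen_self (S : set nat) x : numerical_semigroup S -> two_gen S x x.
Proof.
by move=> hS; apply/two_genP; right; rewrite GRing.subrr; exact: zset0.
Qed.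

Lemma normalized_two_gen (S : set nat) x :
  numerical_semigroup S -> 0 <= x -> normalized_ideals S (two_gen S x).
Proof.
move=> hS x0; apply/normalized_idealsP => //; split.
- by apply/two_genP; left; exact: zset0.
- by move=> i /two_genP[] /zset_ge0; lia.
- move=> i s /two_genP[Si|Si] Ss; apply/two_genP; [left|right].
    exact: zsetD.
  have -> : i + s - x = i - x + s by lia.
  exact: zsetD.
Qed.

Lemma two_gen_sub (S : set nat) (I : set int) x :
  numerical_semigroup S -> normalized_ideals S I -> I x -> two_gen S x `<=` I.
Proof.
move=> hS nI Ix i /two_genP[Si|Si]; first exact: (zset_sub_ideal hS nI).
case/(normalized_idealsP _ hS): nI => _ _ IS.
have -> : i = x + (i - x) by lia.
exact: IS.
Qed.

Lemma two_gen_two_generated (S : set nat) x :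
  numerical_semigroup S -> 0 <= x -> two_gen S x <> zset S ->
  two_generated_ideals S (two_gen S x).
Proof.
move=> hS; case: x => // g _ neqS; exists g => // Sg; apply: neqS.
apply/seteqP; split=> i; last by move=> Si; apply/two_genP; left.
case/two_genP=> // Si; have -> : i = g%:Z + (i - g%:Z) by lia.
by apply: zsetD => //; exact/zset_nat.
Qed.

(** A summand containing g is everything. If g lies in neither summand, both
    parts of a decomposition g = j + k are smaller than g, hence outside g + S,
    hence in S. *)
Lemma two_gen_add_irreducible (S : set nat) (g : nat) (J K : set int) :
  numerical_semigroup S -> gaps S g ->
  normalized_ideals S J -> normalized_ideals S K ->
  two_gen S g%:Z = addset J K -> two_gen S g%:Z = J \/ two_gen S g%:Z = K.
Proof.
move=> hS gapg nJ nK E.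
have [J0 Jge0 _] := (normalized_idealsP J hS).1 nJ.
have [K0 Kge0 _] := (normalized_idealsP K hS).1 nK.
have JP : J `<=` two_gen S g%:Z by rewrite E; exact: sub_addsetl.
have KP : K `<=` two_gen S g%:Z by rewrite E addsetC; exact: sub_addsetl.
have [Jg|nJg] := pselect (J g%:Z).
  by left; apply/seteqP; split=> //; exact: two_gen_sub.
have [Kg|nKg] := pselect (K g%:Z).
  by right; apply/seteqP; split=> //; exact: two_gen_sub.
exfalso; have := two_gen_self g%:Z hS; rewrite E => -[j Jj [k Kk jk]].
have [j0 k0] := (Jge0 _ Jj, Kge0 _ Kk).
have ltjg : j < g%:Z.
  have : j <> g%:Z by move=> jg; apply: nJg; rewrite -jg.
  by lia.
have ltkg : k < g%:Z.
  have : k <> g%:Z by move=> kg; apply: nKg; rewrite -kg.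
  by lia.
have Sj : zset S j by case/two_genP: (JP _ Jj) => // /zset_ge0; lia.
have Sk : zset S k by case/two_genP: (KP _ Kk) => // /zset_ge0; lia.
by apply: gapg; apply/zset_nat; rewrite -jk; exact: zsetD.
Qed.

Lemma two_gen_union_irreducible (S : set nat) (x : int) (J K : set int) :
  numerical_semigroup S -> normalized_ideals S J -> normalized_ideals S K ->
  two_gen S x = J `|` K -> two_gen S x = J \/ two_gen S x = K.
Proof.
move=> hS nJ nK E.
have := two_gen_self x hS; rewrite {1}E => -[Jx|Kx]; [left|right];
  apply/seteqP; split; try exact: two_gen_sub.
- by rewrite E; left.
- by rewrite E; right.
Qed.

(** The order lies inside the additive structure in two ways: J below I gives
    an equation J + J' = I to which irreducibility applies, and J + K is always
    an upper bound of J and K. *)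
Lemma add_irreducible_join_irreducible (S : set nat) (I : set int) :
  numerical_semigroup S -> add_irreducible S I -> join_irreducible S I.
Proof.
move=> hS [nI _ irrI]; split=> // -[J [K [[nJ JI] [nK KI] joinI]]].
case: joinI => _ JleI KleI Imin.
have nJK := normalized_addset hS nJ nK.
have [J' nJ' JJ'] := JleI.
have {J' nJ' JJ'} JI_I : addset J I = I.
  by have [/esym//|IJ'] := irrI _ _ nJ nJ' (esym JJ'); rewrite {1}IJ'.
have leIJK : ideal_le S I (addset J K).
  by apply: Imin => //; [exists K|exists J => //; rewrite addsetC].
have [|EJ|EK] := irrI J K nJ nK; [|exact: (JI (esym EJ))|exact: (KI (esym EK))].
apply/seteqP; split; first exact: (ideal_le_sub hS leIJK).
have KI' := ideal_le_sub hS KleI.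
rewrite -{1}JI_I => _ [j Jj [k Kk <-]].
by exists j => //; exists k => //; exact: KI'.
Qed.

(** * Multiplicity three *)

Lemma zset_mul3 (S : set nat) i :
  numerical_semigroup S -> is_multiplicity S 3 -> 0 <= i -> (3 %| i)%Z ->
  zset S i.
Proof.
move=> [S0 SD _] [_ S3 _]; case: i => // n _ n3; apply/zset_nat.
have /dvdnP[k ->] : (3 %| n)%N by lia.
by elim: k => // k IHk; rewrite mulSn; exact: SD.
Qed.

Lemma least_in_class (S : set nat) (I : set int) (r : int) :
  numerical_semigroup S -> normalized_ideals S I ->
  exists x, [/\ I x, (3 %| x - r)%Z &
    forall i, I i -> (3 %| i - r)%Z -> x <= i].
Proof.
move=> hS nI; have [_ Ige0 _] := (normalized_idealsP I hS).1 nI.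
pose Q n := `[< I n%:Z /\ (3 %| n%:Z - r)%Z >].
have exQ : exists n, Q n.
  have [c cS] := semigroup_conductor hS.
  (* Among the integers from c on, which all lie in S, one is congruent to r. *)
  exists (c + `|((r - c%:Z) %% 3)%Z|)%N; apply/asboolP; split; last by lia.
  by apply: (zset_sub_ideal hS nI); apply/zset_nat/cS; lia.
case: (ex_minnP exQ) => n /asboolP[In n3] nmin.
exists n%:Z; split=> // i Ii i3; have := Ige0 _ Ii.
case: i Ii i3 => // m Im m3 _.
by have := nmin m; rewrite /Q asboolT // => /(_ isT); lia.
Qed.

(** The part of I in each residue class modulo 3 is determined by its least
    element, because adding 3 stays in I. *)
Lemma ideal_two_gen (S : set nat) (I : set int) :
  numerical_semigroup S -> is_multiplicity S 3 -> normalized_ideals S I ->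
  exists x y, [/\ 0 <= x, 0 <= y, (3 %| x - 1)%Z, (3 %| y - 2)%Z &
    I = two_gen S x `|` two_gen S y].
Proof.
move=> hS hS3 nI; have [_ Ige0 _] := (normalized_idealsP I hS).1 nI.
have [x [Ix x1 xmin]] := least_in_class 1 hS nI.
have [y [Iy y2 ymin]] := least_in_class 2 hS nI.
exists x, y; split=> //; [exact: Ige0|exact: Ige0|].
apply/seteqP; split=> [i Ii|i []]; [|exact: two_gen_sub|exact: two_gen_sub].
have i0 := Ige0 _ Ii.
have [i3|] := boolP (3 %| i)%Z.
  by left; apply/two_genP; left; exact: zset_mul3.
have [i1 _|i1 i3] := boolP (3 %| i - 1)%Z.
  left; apply/two_genP; right; have := xmin _ Ii i1.
  by move=> ?; apply: zset_mul3 => //; lia.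
have i2 : (3 %| i - 2)%Z by lia.
right; apply/two_genP; right; have := ymin _ Ii i2.
by move=> ?; apply: zset_mul3 => //; lia.
Qed.

(** The sum is generated by 0, x, y and x + y, and the last generator is
    redundant. *)
Lemma addset_two_gen (S : set nat) x y :
  numerical_semigroup S -> zset S (x + y) ->
  addset (two_gen S x) (two_gen S y) = two_gen S x `|` two_gen S y.
Proof.
move=> hS Sxy; apply/seteqP; split.
- move=> _ [i /two_genP[Si|Si] [j /two_genP[Sj|Sj] <-]].
  + by left; apply/two_genP; left; exact: zsetD.
  + right; apply/two_genP; right.
    have -> : i + j - y = i + (j - y) by lia.
    exact: zsetD.
  + left; apply/two_genP; right.
    have -> : i + j - x = i - x + j by lia.
    exact: zsetD.
  + left; apply/two_genP; left.
    have -> : i + j = (x + y) + ((i - x) + (j - y)) by lia.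
    by apply: zsetD => //; exact: zsetD.
- move=> i [Pi|Pi]; last rewrite addsetC; apply: sub_addsetl => //;
    by apply/two_genP; left; exact: zset0.
Qed.

(** If I + L = M has any solution L among the normalized ideals, then this is
    the largest one. *)
Definition colon (M I : set int) : set int :=
  [set z | forall i, I i -> M (z + i)].

Lemma normalized_colon (S : set nat) (M I : set int) :
  numerical_semigroup S -> normalized_ideals S M -> normalized_ideals S I ->
  I `<=` M -> normalized_ideals S (colon M I).
Proof.
move=> hS /(normalized_idealsP _ hS)[_ Mge0 MS].
move=> /(normalized_idealsP _ hS)[I0 _ _] IM; apply/normalized_idealsP => //.
split=> [i Ii|z /(_ _ I0)|z s zIM Ss i Ii].
- by rewrite GRing.add0r; exact: IM.
- by rewrite GRing.addr0; exact: Mge0.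
- have -> : z + s + i = z + i + s by lia.
  by apply: MS => //; exact: zIM.
Qed.

(** Write m in M = P x + A as a or as x + a with a in A. In the first case
    translation by m keeps 0, x and y, hence all of P x `|` P y, inside M; in
    the second case a = m - x is a nonnegative multiple of 3, so m is already in
    x + S. *)
Lemma mem_add_colon (S : set nat) (M : set int) x y m :
  numerical_semigroup S -> is_multiplicity S 3 ->
  normalized_ideals S M -> ideal_le S (two_gen S x) M ->
  two_gen S x `|` two_gen S y `<=` M -> 0 <= y ->
  (3 %| x + y)%Z -> M m -> (3 %| m - x)%Z ->
  addset (two_gen S x `|` two_gen S y)
    (colon M (two_gen S x `|` two_gen S y)) m.
Proof.
move=> hS hS3 nM [A nA AM] IM y0 xy3 Mm mx.
have [_ Mge0 MS] := (normalized_idealsP M hS).1 nM.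
have [_ Age0 AS] := (normalized_idealsP A hS).1 nA.
have P0 : two_gen S x 0 by apply/two_genP; left; exact: zset0.
have : addset (two_gen S x) A m by rewrite AM.
move=> [p /two_genP[Sp|Sp] [a Aa pam]]; last first.
  exists m; last by exists 0; [move=> i /IM; rewrite GRing.add0r|lia].
  left; apply/two_genP; right; apply: zset_mul3 => //.
  by have := zset_ge0 Sp; have := Age0 _ Aa; lia.
have Am : A m by rewrite -pam GRing.addrC; exact: AS.
exists 0; [by left | exists m; last by lia].
have Mmx : M (m + x).
  by rewrite -AM; exists x; [exact: two_gen_self | exists m => //; lia].
have Mmy : M (m + y).
  apply: (zset_sub_ideal hS nM); apply: zset_mul3 => //; last by lia.
  by have := Mge0 _ Mm; lia.
move=> i [] /two_genP[Si|Si].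
- exact: MS.
- have -> : m + i = m + x + (i - x) by lia.
  exact: MS.
- exact: MS.
- have -> : m + i = m + y + (i - y) by lia.
  exact: MS.
Qed.

(** The elements of an upper bound M outside 3Z are recovered in the class of x
    from M being above P x, and in the class of y from M being above P y. *)
Lemma is_join_two_gen (S : set nat) x y :
  numerical_semigroup S -> is_multiplicity S 3 -> 0 <= x -> 0 <= y ->
  (3 %| x - 1)%Z -> (3 %| y - 2)%Z ->
  is_join S (two_gen S x) (two_gen S y) (two_gen S x `|` two_gen S y).
Proof.
move=> hS hS3 x0 y0 x1 y2.
have nx := normalized_two_gen hS x0; have ny := normalized_two_gen hS y0.
have nI := normalized_setU hS nx ny.
have Sxy : zset S (x + y) by apply: zset_mul3 => //; lia.
have addE := addset_two_gen hS Sxy.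
split=> //.
- by exists (two_gen S y).
- by exists (two_gen S x) => //; rewrite addsetC.
move=> M nM xM yM.
have IM : two_gen S x `|` two_gen S y `<=` M.
  by move=> i []; [exact: ideal_le_sub xM _|exact: ideal_le_sub yM _].
exists (colon M (two_gen S x `|` two_gen S y)); first exact: normalized_colon.
apply/seteqP; split=> [_ [i Ii [z zIM <-]]|m Mm].
  by rewrite GRing.addrC; exact: zIM.
have [m3|m3] := boolP (3 %| m)%Z.
  exists m; last by exists 0; [move=> i /IM; rewrite GRing.add0r|lia].
  left; apply/two_genP; left; apply: zset_mul3 => //.
  by have [_ Mge0 _] := (normalized_idealsP M hS).1 nM; exact: Mge0.
have [m1|m1] := boolP (3 %| m - 1)%Z.
  by apply: mem_add_colon => //; lia.
rewrite setUC; apply: mem_add_colon => //; last 2 first; try lia.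
by rewrite setUC.
Qed.

Theorem proposition24 (S : set nat) (I : set int)
  (hS : numerical_semigroup S) (hS3 : is_multiplicity S 3)
  (hI : (normalized_ideals S `\ zset S) I) :
  [<-> add_irreducible S I;
       join_irreducible S I;
       union_irreducible S I;
       two_generated_ideals S I].
Proof.
have [nI IS] := hI.
have [x [y [x0 y0 x1 y2 IE]]] := ideal_two_gen hS hS3 nI.
have nx := normalized_two_gen hS x0; have ny := normalized_two_gen hS y0.
have two_gen_eq z : 0 <= z -> two_gen S z = I -> two_generated_ideals S I.
  by move=> z0 zI; rewrite -zI; apply: two_gen_two_generated; rewrite ?zI.
have proper_parts : ~ two_generated_ideals S I ->
    (normalized_ideals S `\ I) (two_gen S x) /\
    (normalized_ideals S `\ I) (two_gen S y).
  by move=> nI4; split; split=> // /two_gen_eq; [move/(_ x0)|move/(_ y0)].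
tfae.
- exact: add_irreducible_join_irreducible.
- move=> [_ irrI]; have [g gapg PgI] : two_generated_ideals S I.
    apply: contrapT => /proper_parts[Ix Iy]; apply: irrI.
    exists (two_gen S x), (two_gen S y); split=> //.
    by rewrite IE; exact: is_join_two_gen.
  split=> // -[J [K [[nJ JI] [nK KI] IJK]]].
  have PJK : two_gen S g%:Z = J `|` K by rewrite -IJK.
  have [PJ|PK] := two_gen_union_irreducible hS nJ nK PJK.
    by apply: JI; rewrite -PJ.
  by apply: KI; rewrite -PK.
- move=> [_ irrI]; apply: contrapT => /proper_parts[Ix Iy]; apply: irrI.
  by exists (two_gen S x), (two_gen S y).
- move=> [g gapg PgI]; split=> // J K nJ nK; rewrite -PgI.
  exact: two_gen_add_irreducible.
Qed.
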